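(* Let $D$ be a division ring (finite or infinite), $I$ a set, and $\mathcal{F}$ a filter on $I$ which is not the intersection of finitely many $\mathrm{card}(D)^+$-complete ultrafilters. Then $$\dim_D\,(D^I/\mathcal{F})\ =\ \mathrm{card}(D^I/\mathcal{F}),$$ where $\dim_D$ can be taken to mean the dimension either as a right or as a left $D$-vector space.
   Context: A filter on $I$ is a set of subsets of $I$ containing $I$, closed under passing to larger subsets of $I$, and closed under pairwise intersections; it may be improper (equal to the set of all subsets of $I$). An ultrafilter is a maximal proper filter. A filter is $\kappa$-complete if it is closed under intersections of families of $<\kappa$ members. $\mathrm{card}(D)^+$ is the successor cardinal of $\mathrm{card}(D)$; when $D$ is finite, every ultrafilter is $\mathrm{card}(D)^+$-complete, so in that case the hypothesis simply says that $\mathcal{F}$ is not the intersection of finitely many ultrafilters. Convention: the intersection of the empty family of ultrafilters is the improper filter, and ''finitely many'' allows zero. $D^I/\mathcal{F}$ is the reduced power: the quotient of $D^I$ by the relation $(a_i)\sim(b_i)$ iff $\{i\mid a_i=b_i\}\in\mathcal{F}$, with its induced $D$-vector space structures. *)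

(* Defs.v *)
From HB Require Import structures.
From mathcomp Require Import all_boot all_algebra.
From mathcomp Require Import boolp classical_sets functions cardinality filter.

Set Implicit Arguments.
Unset Strict Implicit.
Unset Printing Implicit Defensive.

Import GRing.Theory.

Local Open Scope classical_set_scope.
Local Open Scope ring_scope.
Local Open Scope card_scope.
Local Open Scope quotient_scope.

Definition card_lt T U (A : set T) (B : set U) : bool :=
  (A #<= B) && ~~ (B #<= A).

Definition is_succ_card (D K : Type) : Prop :=
  card_lt [set: D] [set: K] /\
  forall L : Type, card_lt [set: D] [set: L] -> [set: K] #<= [set: L].

Lemma inj_setT_le (T U : Type) (f : T -> U) :
  injective f -> [set: T] #<= [set: U].
Proof.
move=> finj; apply/card_leP/injfunPex.
by exists (fun x => to_setT (f (val x))) => // x y _ _ /(congr1 val)/finj/val_inj.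
Qed.

Lemma setT_le_inj (T U : Type) :
  [set: T] #<= [set: U] -> exists f : T -> U, injective f.
Proof.
move=> /card_leP[f]; exists (fun x => val (f (to_setT x))) => x y /val_inj fxy.
have := @inj _ _ _ f (to_setT x) (to_setT y).
by rewrite !inE => /(_ I I fxy) /(congr1 val).
Qed.

Lemma cantor_card_lt (D : Type) : card_lt [set: D] [set: set D].
Proof.
apply/andP; split.
  apply: (@inj_setT_le _ _ (fun x : D => [set x])) => x y.
  by move=> /seteqP[/(_ x erefl)].
apply/negP => /setT_le_inj[f finj].
pose A : set D := [set f B | B in [set B : set D | ~ B (f B)]].
have [AA|nAA] := pselect (A (f A)); last by apply: (nAA); exists A.
by have [B nB /finj BA] := AA; apply: nB; rewrite BA.
Qed.

(* Any nonempty family of cardinals has a least member. *)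
Lemma card_min (T : Type) (A : T -> Type) (t1 : T) :
  exists t0, forall t, [set: A t0] #<= [set: A t].
Proof.
pose P (X : set (forall t, A t)) :=
  forall f g t, X f -> X g -> f t = g t -> f = g.
have [F FP Ftot|X [PX Xmax]] := @Zorn_bigcup _ P.
  move=> f g t [Y FY Yf] [Z FZ Zg].
  by have [YZ|ZY] := Ftot _ _ FY FZ;
    [exact: (FP _ FZ _ _ _ (YZ _ Yf))|exact: (FP _ FY _ _ _ Yf (ZY _ Zg))].
have [[t0 t0P]|nsurj] :=
    pselect (exists t0, forall a : A t0, exists f, X f /\ f t0 = a).
  exists t0 => t; have [h hP] := choice t0P.
  apply: (@inj_setT_le _ _ (fun a => h a t)) => a b hab.
  have [[Xa ha] [Xb hb]] := (hP a, hP b).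
  by rewrite -ha -hb (PX _ _ _ Xa Xb hab).
have /(_ _)/cid uP : forall t, exists a : A t, forall f, X f -> f t <> a.
  move=> t; apply: contrapT => /forallNP nt; apply: nsurj; exists t => a.
  have /existsNP[f /not_implyP[Xf /contrapT fa]] := nt a.
  by exists f.
pose u t := sval (uP t); have uX t f : X f -> f t <> u t := svalP (uP t) f.
exfalso; apply: (Xmax (X `|` [set u])).
  split=> [|/(_ u)]; first exact: subsetUl.
  by move=> /(_ (or_intror erefl)) Xu; exact: (uX t1 u Xu).
move=> f g t [Xf|->] [Xg|->] //; first exact: PX.
  by move=> /(uX _ _ Xf).
by move=> /esym/(uX _ _ Xg).
Qed.

Lemma card_le_total (T U : Type) :
  [set: T] #<= [set: U] \/ [set: U] #<= [set: T].
Proof.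
have [[] t0P] := @card_min bool (fun b => if b then T else U) true.
  by left; exact: (t0P false).
by right; exact: (t0P true).
Qed.

Lemma succ_card_exists (D : Type) : exists K : Type, is_succ_card D K.
Proof.
pose T := {S : set (set D) | card_lt [set: D] [set: S]}.
have /andP[Dle DNge] := cantor_card_lt D.
have TD : card_lt [set: D] [set: ([set: set D] : set (set D))].
  have [h hK] : exists h : set D -> ([set: set D] : set (set D)), injective h.
    by exists to_setT => x y /(congr1 val).
  apply/andP; split.
    exact: card_le_trans Dle (inj_setT_le hK).
  by apply: contra DNge; exact: card_le_trans (inj_setT_le hK).
have [[S0 DS0] S0P] :=
  @card_min T (fun S => set_type (sval S)) (exist _ [set: set D] TD).
exists S0; split=> // L /andP[DL LND].
have [/setT_le_inj[f finj]|DL'] := card_le_total L (set D); last first.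
  apply: card_le_trans DL'.
  exact: (@inj_setT_le _ _ (fun x : S0 => val x) val_inj).
have LS : [set: L] #<= [set: range f].
  apply: (@inj_setT_le _ _ (fun x => SigSub (mem_set (imageT f x)))).
  by move=> x y /(congr1 val)/finj.
have SL : [set: range f] #<= [set: L].
  have /choice[g gP] : forall y : range f, exists x, f x = val y.
    by move=> y; have [x _ xy] := set_mem (valP y); exists x.
  apply: (@inj_setT_le _ _ g) => x y gxy.
  by apply: val_inj; rewrite -!gP gxy.
have DS : card_lt [set: D] [set: range f].
  apply/andP; split; first exact: card_le_trans LS.
  by apply: contra LND; exact: card_le_trans.
exact: card_le_trans (S0P (exist _ (range f) DS)) SL.
Qed.

(* A type whose cardinality is the successor cardinal of that of D. *)
Definition succ_card (D : Type) : Type := sval (cid (succ_card_exists D)).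

Lemma succ_cardP (D : Type) : is_succ_card D (succ_card D).
Proof. exact: svalP (cid (succ_card_exists D)). Qed.

(* kappa-completeness for kappa = card K: closure under intersections of fewer
   than kappa members. *)
Definition complete_filter (K I : Type) (F : set_system I) : Prop :=
  forall G : set (set I), G `<=` F -> card_lt G [set: K] ->
    F (\bigcap_(A in G) A).

(* With S = set0 the intersection is the improper filter setT. *)
Definition finite_inter_complete_ultrafilters
    (K I : Type) (F : set_system I) : Prop :=
  exists S : set (set_system I),
    [/\ finite_set S,
        forall U, S U -> UltraFilter U /\ complete_filter K U &
        F = \bigcap_(U in S) U].

(* For V = D^o this is D^I/F as a left D-space; for V = (D^c)^o, over the
   converse ring D^c, it is D^I/F as a right D-space, since there k *: a is
   the function i |-> a i * k. Here F is possibly improper. *)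
Section ReducedPower.
Variables (R : pzRingType) (V : lmodType R) (I : Type) (F : filter_on I).
Implicit Types a b c : I -> V.

Definition eqmodF a b : bool := `[< (F : set_system I) [set i | a i = b i] >].

Lemma eqmodF_refl : reflexive eqmodF.
Proof.
move=> a; apply/asboolP; rewrite (_ : [set i | a i = a i] = setT).
  exact: filterT.
by apply/seteqP.
Qed.

Lemma eqmodF_sym : symmetric eqmodF.
Proof.
by move=> a b; apply/asboolP/asboolP; apply: filterS => i /= ->.
Qed.

Lemma eqmodF_trans : transitive eqmodF.
Proof.
move=> b a c /asboolP ab /asboolP bc; apply/asboolP.
by apply: filterS2 ab bc => i /= -> ->.
Qed.

Canonical eqmodF_equiv := EquivRel eqmodF eqmodF_refl eqmodF_sym eqmodF_trans.

Definition reduced_power := {eq_quot eqmodF}.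

HB.instance Definition _ := Choice.on reduced_power.
HB.instance Definition _ := EqQuotient.on reduced_power.

Local Notation Q := reduced_power.

Definition rp_zero : Q := \pi_Q (0 : I -> V).
Definition rp_opp (x : Q) : Q := \pi_Q (- repr x).
Definition rp_add (x y : Q) : Q := \pi_Q (repr x + repr y).
Definition rp_scale (k : R) (x : Q) : Q := \pi_Q (k *: repr x).

Lemma pi_rpE a b : (\pi_Q a = \pi_Q b) <-> (F : set_system I) [set i | a i = b i].
Proof.
by split=> [/eqmodP/asboolP|Fab] //; apply/eqmodP/asboolP.
Qed.

Lemma rp_oppE a : rp_opp (\pi_Q a) = \pi_Q (- a).
Proof.
apply/pi_rpE.
have /pi_rpE : \pi_Q (repr (\pi_Q a)) = \pi_Q a by rewrite reprK.
by apply: filterS => i /= ai; rewrite !fctE ai.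
Qed.

Lemma rp_addE a b : rp_add (\pi_Q a) (\pi_Q b) = \pi_Q (a + b).
Proof.
apply/pi_rpE.
have /pi_rpE : \pi_Q (repr (\pi_Q a)) = \pi_Q a by rewrite reprK.
have /pi_rpE : \pi_Q (repr (\pi_Q b)) = \pi_Q b by rewrite reprK.
by move=> Fb Fa; apply: filterS2 Fa Fb => i /= ai bi; rewrite !fctE ai bi.
Qed.

Lemma rp_scaleE k a : rp_scale k (\pi_Q a) = \pi_Q (k *: a).
Proof.
apply/pi_rpE.
have /pi_rpE : \pi_Q (repr (\pi_Q a)) = \pi_Q a by rewrite reprK.
by apply: filterS => i /= ai; rewrite !fctE ai.
Qed.

Lemma rp_addA : associative rp_add.
Proof.
elim/quotW=> a; elim/quotW=> b; elim/quotW=> c.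
by rewrite (rp_addE b c) (rp_addE a) (rp_addE a b) (rp_addE (a + b)) addrA.
Qed.

Lemma rp_addC : commutative rp_add.
Proof.
by elim/quotW=> a; elim/quotW=> b; rewrite (rp_addE a b) (rp_addE b a) addrC.
Qed.

Lemma rp_add0 : left_id rp_zero rp_add.
Proof. by elim/quotW=> a; rewrite (rp_addE 0 a) add0r. Qed.

Lemma rp_addN : left_inverse rp_zero rp_opp rp_add.
Proof. by elim/quotW=> a; rewrite (rp_oppE a) (rp_addE (- a) a) addNr. Qed.

HB.instance Definition _ :=
  GRing.isZmodule.Build Q rp_addA rp_addC rp_add0 rp_addN.

Lemma rp_scaleA j k (x : Q) : rp_scale j (rp_scale k x) = rp_scale (j * k) x.
Proof.
elim/quotW: x => a.
by rewrite (rp_scaleE k a) (rp_scaleE j) (rp_scaleE _ a) scalerA.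
Qed.

Lemma rp_scale1 : left_id 1 rp_scale.
Proof. by elim/quotW=> a; rewrite (rp_scaleE 1 a) scale1r. Qed.

Lemma rp_scaleDr : right_distributive rp_scale +%R.
Proof.
move=> k; elim/quotW=> a; elim/quotW=> b.
rewrite [_ + _](rp_addE a b) (rp_scaleE k (a + b)) (rp_scaleE k a).
by rewrite (rp_scaleE k b) scalerDr -rp_addE.
Qed.

Lemma rp_scaleDl (x : Q) : {morph rp_scale^~ x : j k / j + k}.
Proof.
elim/quotW: x => a j k.
rewrite (rp_scaleE (j + k) a) (rp_scaleE j a) (rp_scaleE k a).
by rewrite scalerDl -rp_addE.
Qed.

HB.instance Definition _ := GRing.Zmodule_isLmodule.Build R Q
  rp_scaleA rp_scale1 rp_scaleDr rp_scaleDl.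

End ReducedPower.

Section Dimension.
Variables (R : pzRingType) (V : lmodType R).

Definition lin_indep (B : set V) : Prop :=
  forall (s : seq V) (c : V -> R), uniq s -> [set` s] `<=` B ->
    \sum_(v <- s) c v *: v = 0 -> forall v, v \in s -> c v = 0.

Definition spanning (B : set V) : Prop :=
  forall v : V, exists (s : seq V) (c : V -> R),
    [set` s] `<=` B /\ v = \sum_(u <- s) c u *: u.

Definition is_basis (B : set V) : Prop := lin_indep B /\ spanning B.

(* dim V = card X, as (possibly infinite) cardinals. *)
Definition dim_eq_card T (X : set T) : Prop :=
  exists2 B : set V, is_basis B & B #= X.

End Dimension.

Arguments dim_eq_card {R} V {T} X.

(* Main.v *)
From HB Require Import structures.
Require Import Defs.
From mathcomp Require Import all_boot all_algebra finmap.
From mathcomp Require Import boolp classical_sets functions cardinality filter.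
From mathcomp Require Import wochoice.

(* Write V for D^I/F. Once V has an infinite independent set of size at least
   card D, a basis B satisfies card B <= card V <= card (seq (D * B)) = card B.

   If F is not a finite intersection of ultrafilters, I splits into countably
   many pieces whose complements are not in F; this gives h : I -> nat all of
   whose fibres have their complement outside F. If F is a finite intersection
   of ultrafilters, one of them is not card(D)^+-complete (so D is infinite),
   which gives h : I -> D such that no preimage of a finite set is in F; for D
   infinite the first case gives such an h too. For D finite, the functions
   delta_n o h are independent. For D infinite, it suffices to find card D
   functions g : D -> D of which no nontrivial left linear combination has
   infinitely many zeros, and to take the g o h.

   A maximal such family G has card D elements. Otherwise it is enlarged by a
   function c defined by recursion along a well-order of D whose initial
   segments are smaller than D. If c coincides with a combination of
   b_1, ..., b_m in G at m + 1 points, then the vectors (b_1 y, ..., b_m y) at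
   these points y are right linearly dependent, so that, for the last point y
   involved, c y is a right combination of values of c at earlier points, with
   coefficients that can be fixed in advance. There are fewer than card D such
   values to be avoided by c y. *)

Set Implicit Arguments.
Unset Strict Implicit.
Unset Printing Implicit Defensive.

Import GRing.Theory.

Local Open Scope classical_set_scope.
Local Open Scope ring_scope.
Local Open Scope card_scope.

(** * Cardinal arithmetic *)

(* A pairing is the graph of an injection [A * A -> A], where [A] is its
   domain. *)
Definition pairing_dom T (G : set (T * T * T)) : set T :=
  [set x | exists z, G (x, x, z)].

Definition is_pairing T (G : set (T * T * T)) : Prop :=
  [/\ forall x y z z', G (x, y, z) -> G (x, y, z') -> z = z',
      forall x y x' y' z, G (x, y, z) -> G (x', y', z) -> x = x' /\ y = y',
      forall x y, pairing_dom G x -> pairing_dom G y -> exists z, G (x, y, z) &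
      forall x y z, G (x, y, z) ->
        [/\ pairing_dom G x, pairing_dom G y & pairing_dom G z]].

Lemma pairing_fun T (G : set (T * T * T)) : is_pairing G ->
  exists p : T -> T -> T,
    (forall x y, pairing_dom G x -> pairing_dom G y ->
       G (x, y, p x y) /\ pairing_dom G (p x y)) /\
    (forall x y x' y', pairing_dom G x -> pairing_dom G y ->
       pairing_dom G x' -> pairing_dom G y' ->
       p x y = p x' y' -> x = x' /\ y = y').
Proof.
move=> [Gfun Ginj Gtot Gcl].
have /choice[p pP] : forall u : T * T, exists z,
    pairing_dom G u.1 -> pairing_dom G u.2 -> G (u.1, u.2, z).
  move=> [x y]; have [[Ax Ay]|nA] := pselect (pairing_dom G x /\ pairing_dom G y).
    by have [z Gz] := Gtot _ _ Ax Ay; exists z.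
  by exists x => /= Ax Ay; exfalso; apply: nA.
exists (fun x y => p (x, y)); split=> [x y Ax Ay|x y x' y' Ax Ay Ax' Ay' pE].
  by have Gp := pP (x, y) Ax Ay; split=> //; have [] := Gcl _ _ _ Gp.
apply: Ginj (pP (x, y) Ax Ay) _; rewrite pE; exact: (pP (x', y')).
Qed.

(** Finitely many triples of the union lie in a single member of the chain [F']. Since [G0] is
    adjoined throughout, the empty chain gives a pairing too. *)
Lemma pairing_bigcup T (G0 : set (T * T * T)) (F : set (set (T * T * T))) :
  is_pairing G0 -> total_on F subset ->
  (forall G, F G -> is_pairing (G `|` G0)) ->
  is_pairing (\bigcup_(G in F) G `|` G0).
Proof.
move=> G0P Ftot FP; set U := _ `|` _.
pose F' := [set G0] `|` [set G `|` G0 | G in F].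
have F'P G : F' G -> is_pairing G /\ G `<=` U.
  move=> [->|[H FH <-]]; first by split=> // u; right.
  by split=> [|u [Hu|]]; [exact: FP|left; exists H|right].
have F'tot G H : F' G -> F' H -> exists2 K, F' K & G `<=` K /\ H `<=` K.
  move=> [->|[G' FG <-]] [->|[H' FH <-]].
  - by exists G0; [left|split].
  - by exists (H' `|` G0); [right; exists H'|split=> // u; right].
  - by exists (G' `|` G0); [right; exists G'|split=> // u; right].
  - have [s|s] := Ftot _ _ FG FH.
      by exists (H' `|` G0); [right; exists H'|split=> //; exact: setSU].
    by exists (G' `|` G0); [right; exists G'|split=> //; exact: setSU].
have UF u : U u -> exists2 G, F' G & G u.
  move=> [[G FG Gu]|Gu]; last by exists G0; [left|].
  by exists (G `|` G0); [right; exists G|left].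
have domU G x : F' G -> pairing_dom G x -> pairing_dom U x.
  by move=> /F'P[_ GU] [z Gz]; exists z; exact: GU.
split.
- move=> x y z z' /UF[G FG Gz] /UF[H FH Hz].
  have [K /F'P[[Kf _ _ _] _] [GK HK]] := F'tot _ _ FG FH.
  exact: Kf (GK _ Gz) (HK _ Hz).
- move=> x y x' y' z /UF[G FG Gz] /UF[H FH Hz].
  have [K /F'P[[_ Ki _ _] _] [GK HK]] := F'tot _ _ FG FH.
  exact: Ki (GK _ Gz) (HK _ Hz).
- move=> x y [z /UF[G FG Gz]] [t /UF[H FH Ht]].
  have [K /F'P[[_ _ Kt _] KU] [GK HK]] := F'tot _ _ FG FH.
  have [||w Kw] := Kt x y; first by exists z; exact: GK.
    by exists t; exact: HK.
  by exists w; exact: KU.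
- move=> x y z /UF[G FG Gz]; have [[_ _ _ Gc] _] := F'P _ FG.
  by have [? ? ?] := Gc _ _ _ Gz; split; exact: domU FG _.
Qed.

(* [A] being the domain and [A'] its image under [phi], the three pieces of
   [(A `|` A')^2] other than [A^2] are sent into [A'] by means of [p] and of
   three distinct tags taken in [A]. *)
Lemma pairing_extend T (G : set (T * T * T)) (phi : T -> T) (e : nat -> T) :
  is_pairing G -> (forall n, pairing_dom G (e n)) -> injective e ->
  (forall x, pairing_dom G x -> ~ pairing_dom G (phi x)) ->
  {in pairing_dom G &, injective phi} ->
  exists2 H, is_pairing H & G `<` H.
Proof.
move=> GP eA einj phiA phi_inj; have [p [pA pinj]] := pairing_fun GP.
have [Gfun Ginj Gtot Gcl] := GP; set A := pairing_dom G in phiA phi_inj pA pinj *.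
have {}eA n : A (e n) := eA n.
have {}phi_inj x y : A x -> A y -> phi x = phi y -> x = y.
  by move=> Ax Ay; apply: phi_inj; rewrite inE.
pose t (i j : bool) := e (choice.pickle (i, j)).
have tA i j : A (t i j) by exact: eA.
have tinj i j i' j' : t i j = t i' j' -> i = i' /\ j = j'.
  by move=> /einj /(pcan_inj choice.pickleK)[-> ->].
(* [s false] and [s true] parametrize [A] and [A']; [E i j a b] is the value given to the pair of
   [s i a] and [s j b] unless [i] and [j] are both [false]. *)
pose s (i : bool) x := if i then phi x else x.
have sinj i j x y : A x -> A y -> s i x = s j y -> i = j /\ x = y.
  case: i; case: j => //= Ax Ay; first by move=> /(phi_inj _ _ Ax Ay).
    by move=> xy; case: (phiA _ Ax); rewrite xy.
  by move=> xy; case: (phiA _ Ay); rewrite -xy.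
pose E i j a b := phi (p (t i j) (p a b)).
have Einj i j a b i' j' a' b' : A a -> A b -> A a' -> A b' ->
    E i j a b = E i' j' a' b' -> [/\ i = i', j = j', a = a' & b = b'].
  move=> Aa Ab Aa' Ab'; have [_ Ap] := pA _ _ Aa Ab.
  have [_ Ap'] := pA _ _ Aa' Ab'.
  move=> /(phi_inj _ _ (pA _ _ (tA i j) Ap).2 (pA _ _ (tA i' j') Ap').2).
  by move=> /(pinj _ _ _ _ (tA _ _) Ap (tA _ _) Ap')[/tinj[-> ->]] /pinj[].
pose H : set (T * T * T) := [set u | G u \/ exists i j a b,
  [/\ A a, A b, i || j & u = (s i a, s j b, E i j a b)]].
have domH x : pairing_dom H x <-> exists i a, A a /\ x = s i a.
  split=> [[z [Gz|[i [j [a [b [Aa Ab ij [-> ? ?]]]]]]]]|[[] [a [Aa ->]]]].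
  - by exists false, x; split=> //; exists z.
  - by exists i, a.
  - by exists (E true true a a); right; exists true, true, a, a.
  - by have [z Gz] := Gtot _ _ Aa Aa; exists z; left.
have EA i j a b : A a -> A b -> ~ A (E i j a b).
  by move=> Aa Ab; apply: phiA; apply: (pA _ _ _ _).2 => //; apply: (pA _ _ _ _).2.
exists H; last first.
  split=> [u Gu|HG]; first by left.
  have /HG/Gcl[_ _] : H (s true (e 0%N), s true (e 0%N), E true true (e 0%N) (e 0%N)).
    by right; exists true, true, (e 0%N), (e 0%N); split.
  exact: EA.
split.
- move=> x y z z' [Gz|[i [j [a [b [Aa Ab ij [-> -> ->]]]]]]].
    move=> [|[i [j [a [b [Aa Ab ij [xE yE _]]]]]]]; first exact: Gfun Gz.
    have [Ax Ay _] := Gcl _ _ _ Gz; exfalso.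
    have [iE _] := sinj false i _ _ Ax Aa xE.
    by have [jE _] := sinj false j _ _ Ay Ab yE; rewrite -iE -jE in ij.
  move=> [Gz|[i' [j' [a' [b' [Aa' Ab' ij' [xE yE ->]]]]]]].
    have [Ax Ay _] := Gcl _ _ _ Gz; exfalso; case/orP: ij Ax Ay => -> /=.
      by move=> /(phiA _ Aa).
    by move=> _ /(phiA _ Ab).
  by have [-> ->] := sinj _ _ _ _ Aa Aa' xE; have [-> ->] := sinj _ _ _ _ Ab Ab' yE.
- move=> x y x' y' z [Gz|[i [j [a [b [Aa Ab ij [-> -> ->]]]]]]].
    move=> [|[i [j [a [b [Aa Ab ij [_ _ zE]]]]]]]; first exact: Ginj Gz.
    by have [_ _] := Gcl _ _ _ Gz; rewrite zE => /(EA _ _ _ _ Aa Ab).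
  move=> [/Gcl[_ _] /(EA _ _ _ _ Aa Ab)//|[i' [j' [a' [b' [Aa' Ab' ij' [-> -> zE]]]]]]].
  by have [-> -> -> ->] := Einj _ _ _ _ _ _ _ _ Aa Ab Aa' Ab' zE.
- move=> x y /domH[i [a [Aa ->]]] /domH[j [b [Ab ->]]].
  case: (boolP (i || j)) => [ij|].
    by exists (E i j a b); right; exists i, j, a, b.
  rewrite negb_or => /andP[/negbTE-> /negbTE->].
  by have [z Gz] := Gtot _ _ Aa Ab; exists z; left.
- move=> x y z [/Gcl[Ax Ay Az]|[i [j [a [b [Aa Ab ij [-> -> ->]]]]]]].
    by split; apply/domH; exists false; [exists x|exists y|exists z].
  split; apply/domH; [by exists i, a|by exists j, b|exists true].
  exists (p (t i j) (p a b)); split=> //.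
  by apply: (pA _ _ _ _).2 => //; apply: (pA _ _ _ _).2.
Qed.

(** Zorn's lemma extends a pairing on a copy of [nat] to a maximal one. Its domain [A] is as large
    as [T], so that [T * T] embeds in [A] through [A * A]. *)
Lemma card_le_square T : [set: nat] #<= [set: T] -> [set: T * T] #<= [set: T].
Proof.
move=> /setT_le_inj[e einj].
pose q (m n : nat) := choice.pickle (m, n).
have qinj m n m' n' : q m n = q m' n' -> m = m' /\ n = n'.
  by move=> /(pcan_inj choice.pickleK)[-> ->].
pose G0 : set (T * T * T) := [set u | exists m n, u = (e m, e n, e (q m n))].
have dom0 n : pairing_dom G0 (e n) by exists (e (q n n)), n, n.
have G0P : is_pairing G0.
  split.
  - by move=> x y z z' [m [n [-> -> ->]]] [m' [n' [/einj-> /einj-> ->]]].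
  - by move=> x y x' y' z [m [n [-> -> ->]]] [m' [n' [-> -> /einj/qinj[-> ->]]]].
  - move=> x y [z [m [_ [-> _ _]]]] [t [n [_ [-> _ _]]]].
    by exists (e (q m n)), m, n.
  - by move=> x y z [m [n [-> -> ->]]]; split.
have [F FP Ftot|G [GP Gmax]] := @Zorn_bigcup _ (fun G => is_pairing (G `|` G0)).
  exact: pairing_bigcup.
set M := G `|` G0 in GP; set A := pairing_dom M.
have eA n : A (e n) by have [z Gz] := dom0 n; exists z; right.
have [p [pA pinj]] := pairing_fun GP.
(* If [A] embeds in its complement, [pairing_extend] contradicts maximality. Otherwise the
   complement embeds in [A]. *)
have [|] := card_le_total A (~` A : set T).
  move=> /setT_le_inj[f finj]; exfalso.
  pose phi x := if pselect (A x) is left Ax then val (f (SigSub (mem_set Ax))) else x.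
  have phiE x (Ax : A x) : phi x = val (f (SigSub (mem_set Ax))).
    by rewrite /phi; case: pselect => // Ax'; congr (val (f _)); exact: val_inj.
  have [||H HP [MH HM]] := pairing_extend GP eA einj (phi := phi).
  - by move=> x Ax; rewrite phiE; exact: set_mem (valP (f _)).
  - move=> x y /set_mem Ax /set_mem Ay; rewrite !phiE => /val_inj/finj.
    by move=> /(congr1 val).
  apply: (Gmax H); last by rewrite setUidl// => u G0u; apply: MH; right.
  split; first by move=> u Gu; apply: MH; left.
  by move=> HG; apply: HM => u /HG; left.
move=> /setT_le_inj[f finj].
(* [k] embeds [T] in [A]: the tag [e 0] marks the points of [A], and [e 1] those of its
   complement. *)
pose k x := if pselect (A x) is right nAx
  then p (val (f (SigSub (mem_set (nAx : (~` A) x))))) (e 1%N) else p x (e 0%N).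
have fA x : A (val (f x)) by exact: set_mem (valP (f x)).
have kA x : A (k x) 
  by rewrite /k; case: pselect => Ax; apply: (pA _ _ _ (eA _)).2; [|exact: fA].
have kinj : injective k.
  move=> x y; rewrite /k; case: pselect => Ax; case: pselect => Ay.
  - by move=> /(pinj _ _ _ _ Ax (eA 0%N) Ay (eA 0%N))[].
  - by move=> /(pinj _ _ _ _ Ax (eA 0%N) (fA _) (eA 1%N))[_ /einj].
  - by move=> /(pinj _ _ _ _ (fA _) (eA 1%N) Ay (eA 0%N))[_ /einj].
  - move=> /(pinj _ _ _ _ (fA _) (eA 1%N) (fA _) (eA 1%N))[/val_inj/finj].
    by move=> /(congr1 val).
apply: (@inj_setT_le _ _ (fun u => p (k u.1) (k u.2))) => -[x y] [x' y'] /=.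
by move=> /(pinj _ _ _ _ (kA _) (kA _) (kA _) (kA _))[/kinj-> /kinj->].
Qed.

Lemma card_le_prod T T' U U' : [set: T] #<= [set: T'] -> [set: U] #<= [set: U'] ->
  [set: T * U] #<= [set: T' * U'].
Proof.
move=> /setT_le_inj[f fi] /setT_le_inj[g gi].
apply: (@inj_setT_le _ _ (fun u => (f u.1, g u.2))) => -[x y] [x' y'] /=.
by move=> [/fi-> /gi->].
Qed.

(** A sequence is coded by its length and the nested pairing of its entries; the length tells how
    many times to unpair. *)
Lemma card_le_seq T : [set: nat] #<= [set: T] -> [set: seq T] #<= [set: T].
Proof.
move=> Tinf; have TT := card_le_square Tinf; have [p pinj] := setT_le_inj TT.
have [e einj] := setT_le_inj Tinf.
pose c := foldr (fun x y => p (x, y)) (e 0%N).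
apply: card_le_trans TT.
apply: (@inj_setT_le _ _ (fun s => (e (size s), c s))) => s s' [/einj].
elim: s s' => [|x s IHs] [|x' s'] //= [sE] /pinj[-> cE].
by rewrite (IHs s').
Qed.

Lemma not_card_le_finite T U (X : set T) (A : set U) :
  [set: nat] #<= X -> finite_set A -> ~ (X #<= A).
Proof. by move=> Xinf /finite_setPn Afin /(card_le_trans Xinf). Qed.

Lemma card_setX_le T U V (A : set T) (B : set U) :
  A #<= [set: V] -> B #<= [set: V] -> A `*` B #<= [set: V * V].
Proof.
rewrite -(card_le_eql (card_setT A)) -(card_le_eql (card_setT B)).
move=> /setT_le_inj[f fi] /setT_le_inj[g gi].
rewrite -(card_le_eql (card_setT (A `*` B))).
have h1 (u : A `*` B) : (val u).1 \in A by have /set_mem[/mem_set] := valP u.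
have h2 (u : A `*` B) : (val u).2 \in B by have /set_mem[_ /mem_set] := valP u.
apply: (@inj_setT_le _ _ (fun u => (f (SigSub (h1 u)), g (SigSub (h2 u))))).
move=> u v [/fi/(congr1 val)/= e1 /gi/(congr1 val)/= e2]; apply: val_inj.
by rewrite [LHS]surjective_pairing e1 e2 -surjective_pairing.
Qed.

(** With [V] the larger of [A] and [B], the product embeds in [V * V], which is finite or no larger
    than [V]. *)
Lemma not_card_le_setX X T U (A : set T) (B : set U) :
  [set: nat] #<= [set: X] -> ~ ([set: X] #<= A) -> ~ ([set: X] #<= B) ->
  ~ ([set: X] #<= A `*` B).
Proof.
move=> Xinf XA XB; have [V XV [AV BV]] :
    exists2 V : Type, ~ ([set: X] #<= [set: V]) & A #<= [set: V] /\ B #<= [set: V].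
  have [] := card_le_total A B => le.
    exists B; first by rewrite (card_le_eqr (card_setT B)).
    by split; [rewrite -(card_le_eql (card_setT A))|rewrite (card_le_eqr (card_setT B))].
  exists A; first by rewrite (card_le_eqr (card_setT A)).
  by split; [rewrite (card_le_eqr (card_setT A))|rewrite -(card_le_eql (card_setT B))].
move=> XAB; have {XAB} XVV := card_le_trans XAB (card_setX_le AV BV).
have [Vfin|/infiniteP Vinf] := pselect (finite_set [set: V]).
  apply: not_card_le_finite Xinf _ XVV; rewrite -setXTT; exact: finite_setX.
by apply: XV; apply: card_le_trans XVV _; exact: card_le_square.
Qed.

Lemma not_card_le_fsets X (T : choiceType) (A : set T) :
  [set: nat] #<= [set: X] -> ~ ([set: X] #<= A) ->
  ~ ([set: X] #<= [set S : {fset T} | [set` S] `<=` A]).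
Proof.
move=> Xinf XA; have [Afin|/infiniteP Ainf] := pselect (finite_set A).
  apply: not_card_le_finite Xinf _.
  apply: sub_finite_set (finite_fset (fpowerset (fset_set A))) => S SA /=.
  rewrite fpowersetE; apply/fsubsetP => x xS; rewrite in_fset_set// inE.
  exact: SA.
(* For [A] infinite, a finite subset is determined by the sequence of its elements, and [seq A] is
   no larger than [A]. *)
move=> XS; apply: XA; apply: card_le_trans XS _.
rewrite -(card_le_eqr (card_setT A)).
have /card_le_seq : [set: nat] #<= [set: A] by rewrite (card_le_eqr (card_setT A)).
apply: card_le_trans.
rewrite -(card_le_eql (card_setT [set S : {fset T} | [set` S] `<=` A])).
apply: (@inj_setT_le _ _ (fun S => pmap insub (enum_fset (val S)))) => S S' SS'.
have pmapK (U : [set S : {fset T} | [set` S] `<=` A]) :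
    [seq val x | x <- pmap insub (enum_fset (val U)) : seq A] = enum_fset (val U).
  rewrite pmap_filter; last exact: insubK.
  apply/all_filterP/allP => x xU; rewrite isSome_insub inE.
  by have /set_mem := valP U; apply.
by apply: val_inj; apply/fsetP => x; rewrite -[x \in _]/(x \in enum_fset _)
  -pmapK SS' pmapK.
Qed.

(** * Well-orders and recursion *)

Lemma wf_of_min X (R : X -> X -> Prop) :
  (forall P : set X, P !=set0 -> exists2 z, P z & forall x, P x -> ~ R x z) ->
  well_founded R.
Proof.
move=> Rmin x; apply: contrapT => nAx.
have [|z nAz zmin] := Rmin [set x | ~ Acc R x]; first by exists x.
by apply: nAz; constructor => y Ryz; apply: contrapT => /zmin/(_ Ryz).
Qed.

(** A strict well-order of [X] whose type is an initial ordinal. *)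
Definition initial_order X (R : X -> X -> Prop) : Prop :=
  [/\ well_founded R, forall x y z, R x y -> R y z -> R x z,
      forall x y, x <> y -> R x y \/ R y x &
      forall x, ~ ([set: X] #<= [set y | R y x])].

Lemma initial_order_exists X : exists R : X -> X -> Prop, initial_order R.
Proof.
have [le le_wo] := well_ordering_principle {classic X}.
have le_min (P : set X) : P !=set0 -> exists2 z, P z & forall x, P x -> le z x.
  move=> [x Px]; have [|z [[zP zmin] _]] := le_wo (fun y => `[< P y >]).
    by exists x; exact/asboolP.
  exists z; first exact/asboolP.
  by move=> y Py; apply: zmin; exact/asboolP.
(* The order axioms are read off from the unique minima of sets of at most three elements. *)
have le_refl x : le x x.
  by have [|z -> zmin] := le_min [set x]; [exists x|exact: zmin].
have le_anti x y : le x y -> le y x -> x = y.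
  move=> xy yx; have [|z [_ zU]] := le_wo (pred2 x y).
    by exists x; rewrite inE eqxx.
  transitivity z; [apply/esym|]; apply: zU; split; rewrite ?inE ?eqxx ?orbT//.
    by move=> t /orP[] /eqP->.
  by move=> t /orP[] /eqP->.
pose lt x y := ~ le y x.
have lt_min (P : set X) : P !=set0 -> exists2 z, P z & forall x, P x -> ~ lt x z.
  by move=> /le_min[z Pz zmin]; exists z => // x /zmin zx; exact.
have lt_trans x y z : lt x y -> lt y z -> lt x z.
  move=> xy yz zx; have [|w] := le_min [set x; y; z]; first by exists x; left; left.
  move=> [[]|] -> wmin.
  - apply: yz; rewrite -(le_anti x z) ?(wmin y)//; first by left; right.
    by apply: wmin; right.
  - by apply: xy; apply: wmin; left; left.
  - by apply: yz; apply: wmin; left; right.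
have lt_total x y : x <> y -> lt x y \/ lt y x.
  move=> xy; apply: contrapT => /not_orP[/contrapT yx /contrapT xy'].
  exact/xy/le_anti.
have [|small] := pselect (exists y, [set: X] #<= [set z | lt z y]); last first.
  exists lt; split; [exact: wf_of_min|exact: lt_trans|exact: lt_total|].
  by move=> x Xx; apply: small; exists x.
(* [y] is least among the points with a segment as large as [X]. The order is pulled back along an
   injection [g] of [X] into that segment, so the segment of [x] embeds in that of [g x], which is
   smaller than [X]. *)
move=> /lt_min[y + ymin]; rewrite /= -(card_le_eqr (card_setT _)).
move=> /setT_le_inj[f finj].
pose g x := val (f x); have ginj : injective g by move=> x x' /val_inj/finj.
have gy x : lt (g x) y by exact: set_mem (valP (f x)).
exists (fun x x' => lt (g x) (g x')); split.
- apply: wf_of_min => P [x Px]; have [|_ [z Pz <-] zmin] := lt_min (g @` P).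
    by exists (g x), x.
  by exists z => // t Pt; apply: zmin; exists t.
- by move=> x x' x''; exact: lt_trans.
- by move=> x x' xx'; apply: lt_total => /ginj.
- move=> x Xx; apply: (ymin (g x)); last exact: gy.
  apply: card_le_trans Xx _; apply: card_le_trans (subset_card_le _).
    by rewrite -(card_le_eql (inj_card_eq (f := g) _)) //; exact: in2W.
  by move=> _ [t gt <-].
Qed.

(** The recursion provides only the values below [x]; they are extended by [y0] to a total function,
    and the locality of [Q] makes this default harmless. *)
Lemma wf_choice X Y (R : X -> X -> Prop) (Q : X -> (X -> Y) -> Y -> Prop) :
  inhabited Y -> well_founded R ->
  (forall x f, exists v, Q x f v) ->
  (forall x f g v, (forall z, R z x -> f z = g z) -> Q x f v -> Q x g v) ->
  exists c, forall x, Q x c (c x).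
Proof.
move=> [y0] Rwf /(_ _ _)/cid Qex Qloc.
pose ext x (r : forall z, R z x -> Y) z :=
  if pselect (R z x) is left h then r z h else y0.
pose step x r := sval (Qex x (ext x r)).
pose c := Fix Rwf (fun _ => Y) step.
have cE x : c x = step x (fun z _ => c z).
  rewrite /c Fix_eq// => {}x r r' rr'; rewrite /step (_ : r = r')//.
  by apply/functional_extensionality_dep => z; exact/funext.
exists c => x; rewrite cE; apply: Qloc (svalP (Qex _ _)) => z Rzx.
by rewrite /ext; case: pselect.
Qed.

(** * Linear algebra over a division ring *)

(* For [N = [set 0]] this is [lin_indep]; the set [N] need not be a submodule. *)
Definition indep_mod (R : pzRingType) (V : lmodType R) (N B : set V) : Prop :=
  forall (s : seq V) (c : V -> R), uniq s -> [set` s] `<=` B ->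
    N (\sum_(v <- s) c v *: v) -> forall v, v \in s -> c v = 0.

Lemma chain_seq (T : eqType) (F : set (set T)) (s : seq T) :
  total_on F subset -> F !=set0 -> [set` s] `<=` \bigcup_(X in F) X ->
  exists2 X, F X & [set` s] `<=` X.
Proof.
move=> Ftot [X0 FX0]; elim: s => [_|x s IHs xsF]; first by exists X0.
have [|X FX sX] := IHs; first by move=> y ys; apply: xsF; rewrite /= inE ys orbT.
have [|Y FY Yx] := xsF x; first by rewrite /= inE eqxx.
have [XY|YX] := Ftot _ _ FX FY.
  by exists Y => // y; rewrite /= inE => /orP[/eqP->//|/sX/XY].
by exists X => // y; rewrite /= inE => /orP[/eqP->|/sX//]; exact: YX.
Qed.

Lemma indep_mod_image (R : pzRingType) (V W : lmodType R) (phi : {linear V -> W})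
    (N B : set V) : 1 != 0 :> R ->
  (forall v, phi v = 0 -> N v) -> indep_mod N B ->
  {in B &, injective phi} /\ lin_indep (phi @` B).
Proof.
move=> R1 phiN Bind; split=> [u v /set_mem Bu /set_mem Bv uv|s c s_uniq sB sc0].
  apply/eqP; apply: contraT => neq_uv.
  pose c x : R := if x == u then 1 else -1.
  have /(_ u) : forall x, x \in [:: u; v] -> c x = 0.
    apply: Bind; first by rewrite /= inE neq_uv.
      by move=> x; rewrite /= !inE => /orP[] /eqP->.
    apply: phiN; rewrite !big_cons big_nil addr0 /c eqxx eq_sym (negbTE neq_uv).
    by rewrite scale1r scaleN1r linearB uv subrr.
  by rewrite /c eqxx inE eqxx => /(_ isT)/eqP; rewrite (negbTE R1).
have /choice[r rP] : forall w, exists v, (phi @` B) w -> B v /\ phi v = w.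
  by move=> w; have [[v Bv <-]|nB] := pselect ((phi @` B) w); [exists v|exists 0].
have phir w : w \in s -> phi (r w) = w by move=> /sB/rP[].
have rs_uniq : uniq [seq r w | w <- s].
  by rewrite map_inj_in_uniq// => w w' ws ws' rE; rewrite -(phir w)// rE phir.
move=> w ws; rewrite -(phir w ws); apply: (Bind _ (c \o phi) rs_uniq); last exact: map_f.
  by move=> _ /mapP[w' w's ->]; have [] := rP w' (sB _ w's).
apply: phiN; rewrite big_map linear_sum/= -[RHS]sc0 !big_seq.
by apply: eq_bigr => w' w's; rewrite linearZ/= phir.
Qed.

(** For a maximal [B], adjoining [v] creates a combination in [N] whose coefficient at [v] is
    nonzero; dividing by it puts [v] minus a combination of [B] in [N]. *)
Lemma indep_mod_maximal (R : pzRingType) (V : lmodType R) (N A : set V) :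
  (forall x : R, x != 0 -> exists y, y * x = 1) ->
  N 0 -> (forall a v, N v -> N (a *: v)) -> indep_mod N A ->
  exists B, [/\ A `<=` B, indep_mod N B &
    forall v, exists (s : seq V) (c : V -> R),
      [set` s] `<=` B /\ N (v - \sum_(u <- s) c u *: u)].
Proof.
move=> invR N0 NZ Aind.
have [F FP Ftot|X [Xind Xmax]] := @Zorn_bigcup _ (fun X => indep_mod N (A `|` X)).
  have [->|/set0P[X0 FX0]] := eqVneq F set0; first by rewrite bigcup_set0 setU0.
  move=> s c s_uniq sF.
  have [_ [X FX <-] sX] : exists2 Y, [set A `|` X | X in F] Y & [set` s] `<=` Y.
    apply: chain_seq.
    - move=> _ _ [X FX <-] [Y FY <-].
      by have [XY|YX] := Ftot _ _ FX FY; [left|right]; exact: setUS.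
    - by exists (A `|` X0), X0.
    - move=> x /sF[Ax|[X FX Xx]]; first by exists (A `|` X0); [exists X0|left].
      by exists (A `|` X); [exists X|right].
  exact: (FP _ FX s c s_uniq sX).
exists (A `|` X); split=> // v.
have [Bv|nBv] := pselect ((A `|` X) v).
  exists [:: v], (fun=> 1); split; first by move=> x; rewrite /= inE => /eqP->.
  by rewrite big_seq1 scale1r subrr.
have /Xmax : X `<` v |` X.
  split; first by move=> x; right.
  by move=> vX; apply: nBv; right; apply: vX; left.
move=> /existsNP[s /existsNP[c /not_implyP[s_uniq /not_implyP[sB]]]].
move=> /not_implyP[Nsum /existsNP[w /not_implyP[ws /eqP cw]]].
have sB' u : u \in s -> u != v -> (A `|` X) u.
  by move=> /sB[|[->|]]; [left|rewrite eqxx|right].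
have [vs|nvs] := boolP (v \in s); last first.
  exfalso; move/eqP: cw; apply; apply: Xind s_uniq _ Nsum _ ws => u us.
  by apply: sB' => //; apply: contra nvs => /eqP <-.
have remB : [set` rem v s] `<=` A `|` X.
  by move=> u; rewrite /= mem_rem_uniq// inE => /andP[/[swap]]; exact: sB'.
move: Nsum; rewrite (perm_big _ (perm_to_rem vs)) big_cons /= => Nsum.
have [cv0|cv] := eqVneq (c v) 0.
  exfalso; move: Nsum; rewrite cv0 scale0r add0r => Nsum.
  move/eqP: (cw); apply; apply: Xind (rem_uniq _ s_uniq) remB Nsum _ _.
  by rewrite mem_rem_uniq// inE ws andbT; apply: contraNneq cw => ->; rewrite cv0.
have [a acv] := invR _ cv; exists (rem v s), (fun u => - (a * c u)); split=> //.
have := NZ a _ Nsum; rewrite scalerDr scalerA acv scale1r scaler_sumr -sumrN.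
by congr (N (_ + _)); apply: eq_bigr => u _; rewrite scaleNr opprK scalerA.
Qed.

Lemma seq_max (T : eqType) (R : T -> T -> Prop) (s : seq T) :
  (forall x y z, R x y -> R y z -> R x z) ->
  (forall x y, x <> y -> R x y \/ R y x) -> s != [::] ->
  exists2 y, y \in s & forall z, z \in s -> z != y -> R z y.
Proof.
move=> Rtr Rtot; elim: s => // x s IHs _; have [->|/IHs[y ys ymax]] := eqVneq s [::].
  by exists x => [|z]; rewrite inE // => /eqP->; rewrite eqxx.
have [yx|/eqP/Rtot[xy|yx]] := eqVneq y x.
- by exists y => [|z]; rewrite inE ?ys ?orbT// -yx => /orP[/eqP->|/ymax//]; rewrite eqxx.
- exists x => [|z]; rewrite inE ?eqxx// => /orP[/eqP->|zs _]; first by rewrite eqxx.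
  by have [->//|/(ymax _ zs)zy] := eqVneq z y; exact: Rtr xy.
- exists y => [|z]; rewrite inE ?ys ?orbT// => /orP[/eqP->//|]; exact: ymax.
Qed.

(** * Families of functions on a division ring *)

Section DivisionRing.
Variables (D : unitRingType) (divD : GRing.field_axiom D).

(** Gaussian elimination: a function [b] vanishing on [s] is dropped; otherwise it serves to
    eliminate a point [y] with [b y != 0]. *)
Lemma right_dependent (T : eqType) (L : seq (T -> D)) (s : seq T) :
  uniq s -> (size L < size s)%N ->
  exists k : T -> D, (exists2 y, y \in s & k y != 0) /\
    forall b, b \in L -> \sum_(y <- s) b y * k y = 0.
Proof.
elim: {L}(size L) {-2}L (erefl (size L)) s => [|n IHn] [|b L]//= sizeL s s_uniq.
  by case: s s_uniq => // y s _ _; exists (fun=> 1); split=> //; exists y;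
    rewrite ?mem_head ?oner_neq0.
case: sizeL => sizeL ltLs.
have [[y ys by0]|b0] := pselect (exists2 y, y \in s & b y != 0); last first.
  have [|k [kn0 kL]] := IHn L sizeL s s_uniq.
    exact: ltn_trans (ltnSn _) ltLs.
  exists k; split=> // b'; rewrite inE => /orP[/eqP->|/kL//].
  rewrite big_seq big1// => y ys; rewrite (_ : b y = 0) ?mul0r//.
  by apply/eqP; apply: contraT => by0; case: b0; exists y.
(* Subtracting a left multiple of [b] makes [b'] vanish at [y] and is compatible with coefficients
   on the right. *)
pose b1 (b' : T -> D) z := b' z - b' y * (b y)^-1 * b z.
have sizeL1 : size [seq b1 b' | b' <- L] = n by rewrite size_map.
have [|k [[z zs kz] kL]] := IHn _ sizeL1 (rem y s) (rem_uniq _ s_uniq).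
  by rewrite sizeL1 -sizeL size_rem// ltn_predRL.
have ys0 : y \notin rem y s by rewrite mem_rem_uniq// inE eqxx.
(* The value at [y] is the one that solves the equation of [b]. *)
pose k' t := if t == y then - ((b y)^-1 * \sum_(x <- rem y s) b x * k x) else k t.
have sumk' f : \sum_(x <- s) f x * k' x = f y * k' y + \sum_(x <- rem y s) f x * k x.
  rewrite (perm_big _ (perm_to_rem ys)) big_cons /=; congr (_ + _).
  rewrite !big_seq; apply: eq_bigr => x xs; rewrite /k' ifN//.
  by apply: contraNneq ys0 => xy; rewrite xy in xs.
exists k'; split.
  exists z; first exact: mem_rem zs.
  by rewrite /k' ifN//; apply: contraNneq ys0 => zy; rewrite zy in zs.
move=> b'; rewrite inE sumk' {1}/k' eqxx => /orP[/eqP->|b'L].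
  by rewrite mulrN mulVKr ?addNr//; exact: divD.
rewrite -[RHS](kL _ (map_f b1 b'L)) /b1 mulrN mulrA mulr_sumr addrC -sumrB.
by apply: eq_bigr => x _; rewrite mulrBl !mulrA.
Qed.

Lemma linear_combE (T : Type) (s : seq (T -> D^o)) (d : (T -> D^o) -> D) (x : T) :
  (\sum_(b <- s) d b *: b) x = \sum_(b <- s) d b * b x.
Proof. by rewrite fct_sumE. Qed.

Lemma avoid_combinations (G : set (D -> D^o)) :
  [set: nat] #<= [set: D] -> ~ ([set: D] #<= G) ->
  exists c : D -> D, forall (s : seq (D -> D^o)) (d : (D -> D^o) -> D),
    [set` s] `<=` G -> finite_set [set y | c y = \sum_(b <- s) d b * b y].
Proof.
move=> Dinf DG; have [R [Rwf Rtr Rtot Rsmall]] := initial_order_exists D.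
(* The coefficients [k (L, S, y)] are chosen independently of [c]. *)
pose rel (L : {fset D -> D^o}) (S : {fset D}) y (k : D -> D) :=
  forall b, b \in L -> b y = \sum_(z <- S) b z * k z.
have /choice[k kP] : forall u : {fset D -> D^o} * {fset D} * D, exists k,
    (exists k', rel u.1.1 u.1.2 u.2 k') -> rel u.1.1 u.1.2 u.2 k.
  move=> u; have [[k' k'P]|nk'] := pselect (exists k', rel u.1.1 u.1.2 u.2 k').
    by exists k'.
  by exists (fun=> 0).
pose below y := [set z | R z y].
have [||||c cP] := @wf_choice D D R (fun y f v =>
    forall (L : {fset D -> D^o}) (S : {fset D}), [set` L] `<=` G ->
    [set` S] `<=` below y -> v <> \sum_(z <- S) f z * k (L, S, y) z).
- by constructor; exact: 0.
- exact: Rwf.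
- move=> y f; apply: contrapT => /forallNP nv.
  (* If every [v] were forbidden, mapping it to a pair [(L, S)] that forbids it would embed [D] in a
     set of pairs smaller than [D]. *)
  have /choice[g gP] : forall v, exists u : {fset D -> D^o} * {fset D},
      ([set L : {fset D -> D^o} | [set` L] `<=` G] `*`
       [set S : {fset D} | [set` S] `<=` below y]) u /\
      v = \sum_(z <- u.2) f z * k (u, y) z.
    move=> v; have /existsNP[L /existsNP[S]] := nv v.
    move=> /not_implyP[LG /not_implyP[Sy /contrapT vE]].
    by exists (L, S).
  apply: (not_card_le_setX Dinf (not_card_le_fsets Dinf DG)
    (not_card_le_fsets Dinf (Rsmall y))).
  rewrite -(card_le_eqr (card_setT _)).
  apply: (@inj_setT_le _ _ (fun v => SigSub (mem_set (gP v).1))) => v v'.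
  by move=> /(congr1 val)/= gvv'; rewrite (gP v).2 (gP v').2 gvv'.
- move=> y f g v fg vf L S LG Sy.
  rewrite (eq_big_seq (fun z => f z * k (L, S, y) z)); first exact: vf.
  by move=> z zS; rewrite fg//; exact: Sy.
(* An infinite coincidence set contains a finite [B] with more points than [s] has functions, which
   yields a right dependence [h]. *)
exists c => s d sG; apply: contrapT => /(infinite_set_fset (size s).+1)[B BE Bsize].
have [||h [[y0 y0B hy0] hs]] := @right_dependent D s (enum_fset B).
- exact: fset_uniq.
- exact: Bsize.
(* [t] is the support of [h] in [B]; its other points all lie below its greatest one [y]. *)
pose t := [seq y <- enum_fset B | h y != 0].
have [|y yt ymax] := @seq_max D R t Rtr Rtot.
  have : y0 \in t by rewrite mem_filter hy0.
  by case: (t).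
have [hy yB] : h y != 0 /\ y \in B by move: yt; rewrite mem_filter => /andP.
pose S := [fset z in t | z != y]%fset; pose L := [fset b in s]%fset.
have Sy : [set` S] `<=` below y.
  by move=> z; rewrite /= !inE => /andP[]; exact: ymax.
have SE f : \sum_(z <- S) f z * h z = - (f y * h y) + \sum_(z <- enum_fset B) f z * h z.
  rewrite [X in _ = _ + X](big_rem y)//= addKr.
  rewrite [RHS](bigID (fun z => h z == 0))/= [X in _ = X + _]big1.
    rewrite add0r -[RHS]big_filter; apply: perm_big; apply: uniq_perm.
    - exact: fset_uniq.
    - by rewrite filter_uniq// rem_uniq// fset_uniq.
    - move=> z; rewrite !inE/= !mem_filter mem_rem_uniq ?fset_uniq// !inE.
      by rewrite -andbA [(_ != y) && _]andbC.
  by move=> z /eqP->; rewrite mulr0.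
(* The dependence is solved for the values at [y]. The coefficients [k (L, S, y)] may differ from
   this solution but satisfy the same relation. *)
have exk : exists k', rel L S y k'.
  exists (fun z => - (h z * (h y)^-1)) => b; rewrite inE => bs.
  under eq_bigr do rewrite mulrN mulrA.
  by rewrite sumrN -mulr_suml SE hs// addr0 mulNr opprK mulrK//; exact: divD.
have relk : rel L S y (k (L, S, y)) := kP (L, S, y) exk.
apply: (cP y L S) => //; first by move=> b; rewrite /= inE; exact: sG.
have cE z : z \in B -> c z = \sum_(b <- s) d b * b z by exact: BE.
(* Expanding [c] on both sides as the combination of [s] shows that [c y] is the value forbidden by
   [(L, S)]. *)
rewrite cE// (eq_big_seq (fun z => \sum_(b <- s) d b * (b z * k (L, S, y) z))).
  rewrite exchange_big/= !big_seq; apply: eq_bigr => b bs.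
  by rewrite -mulr_sumr -relk// inE.
move=> z zS; rewrite cE; last by move: zS; rewrite !inE mem_filter -andbA => /and3P[].
by rewrite mulr_suml; apply: eq_bigr => b _; rewrite mulrA.
Qed.

(** If a maximal [G] were smaller than [D], the function from [avoid_combinations] would still agree
    with some combination of [G] at infinitely many points. *)
Lemma strong_family : [set: nat] #<= [set: D] ->
  exists2 G : set (D -> D^o), [set: D] #<= G &
    indep_mod [set f | infinite_set [set y | f y = 0]] G.
Proof.
move=> Dinf; set N := [set f : D -> D^o | _].
have [||||G [_ Gind Gmax]] := @indep_mod_maximal D (D -> D^o) N set0.
- by move=> x x0; exists x^-1; rewrite mulVr//; exact: divD.
- rewrite /N /= (_ : [set _ | _] = setT); first exact/infiniteP.
  by apply/seteqP.
- move=> a f; apply: contra_not; apply: sub_finite_set => y /= fy.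
  by rewrite -[LHS]/(a * f y) fy mulr0.
- by move=> [|v s] c // _ /(_ v); rewrite /= inE eqxx => /(_ isT).
exists G => //; apply: contrapT => DG.
have [c cP] := avoid_combinations Dinf DG; have [s [d [sG]]] := Gmax c.
apply; apply: sub_finite_set (cP s d sG) => y /=.
by rewrite -linear_combE => /eqP; rewrite subr_eq0 => /eqP.
Qed.

End DivisionRing.

(** * Filters and ultrafilters *)

Definition finite_inter_ultrafilters I (F : set_system I) : Prop :=
  exists S : set (set_system I),
    [/\ finite_set S, forall U, S U -> UltraFilter U & F = \bigcap_(U in S) U].

(** If each set or its complement is in [F], then [F] is either improper, an intersection of no
    ultrafilters, or itself an ultrafilter. *)
Lemma filter_split I (F : set_system I) : Filter F ->
  ~ finite_inter_ultrafilters F -> exists X, ~ F X /\ ~ F (~` X).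
Proof.
move=> FF nF; apply: contrapT => /forallNP nX.
have FX X : F X \/ F (~` X) by have /not_andP[/contrapT|/contrapT] := nX X; [left|right].
apply: nF; have [F0|nF0] := pselect (F set0).
  exists set0; split=> //; rewrite bigcap_set0; apply/seteqP; split=> // X _.
  exact: filterS F0.
exists [set F]; split; [exact: finite_set1| |by rewrite bigcap_set1].
move=> _ ->; split=> // G GG FG; apply/seteqP; split=> // X GX.
have [//|/FG GX'] := FX X; exfalso.
by apply: (@filter_not_empty _ G); rewrite -(setICr X); exact: filterI.
Qed.

Lemma within_splitU I (F : set_system I) (A B : set I) : Filter F ->
  within (A `|` B) F = within A F `&` within B F.
Proof.
move=> FF; apply/seteqP; split=> X; rewrite /within/=.
  by move=> FX; split; apply: filterS FX => i Xi ?; apply: Xi; [left|right].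
by move=> [FA FB]; apply: filterS2 FA FB => i Xa Xb [/Xa|/Xb].
Qed.

Lemma withinT I (F : set_system I) : Filter F -> within setT F = F.
Proof.
move=> FF; apply/seteqP; split=> X; rewrite /within/=; apply: filterS => i //.
exact.
Qed.

(** If [X] splits [within A F], this filter is the intersection of its restrictions to the two
    halves of [A]. One of these is not a finite intersection of ultrafilters and gives [B]; the
    other half is the part removed. *)
Lemma nonultra_within_split I (F : set_system I) (A : set I) : Filter F ->
  ~ finite_inter_ultrafilters (within A F) ->
  exists B, [/\ B `<=` A, ~ finite_inter_ultrafilters (within B F) &
    ~ F (~` (A `\` B))].
Proof.
move=> FF nA; have [X [nX nXC]] := filter_split (within_filter A FF) nA.
have [nB|] := pselect (~ finite_inter_ultrafilters (within (A `&` X) F)).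
  exists (A `&` X); split; [exact: subIsetl|exact: nB|].
  apply: contra_not nX; apply: filterS => i /= h Ai; apply: contrapT => nXi.
  by apply: h; split=> // -[].
move=> /contrapT[S [Sfin SU SE]]; exists (A `\` X); split; first exact: subDsetl.
  move=> [T [Tfin TU TE]]; apply: nA; exists (S `|` T); split.
  - by rewrite finite_setU.
  - by move=> U [/SU|/TU].
  by rewrite bigcap_setU -SE -TE -within_splitU// setUIDK.
apply: contra_not nXC; apply: filterS => i /= h Ai Xi; apply: h.
by split=> // -[].
Qed.

Lemma nonultra_nat_fibres I (F : set_system I) : Filter F ->
  ~ finite_inter_ultrafilters F ->
  exists h : I -> nat, forall n, ~ F [set i | h i <> n].
Proof.
move=> FF nF.
have /choice[g gP] : forall A, exists B,
    ~ finite_inter_ultrafilters (within A F) ->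
    [/\ B `<=` A, ~ finite_inter_ultrafilters (within B F) & ~ F (~` (A `\` B))].
  move=> A; have [fA|] := pselect (finite_inter_ultrafilters (within A F)).
    by exists A.
  by move=> /nonultra_within_split[B BP]; exists B.
pose A n := iter n g setT.
have nA n : ~ finite_inter_ultrafilters (within (A n) F).
  by elim: n => [|n /gP[]//]; rewrite withinT.
have Asub m n : (m <= n)%N -> A n `<=` A m.
  elim: n => [|n IHn]; first by rewrite leqn0 => /eqP->.
  rewrite leq_eqVlt => /orP[/eqP->//|/IHn]; apply: subset_trans.
  by have [] := gP _ (nA n).
pose J n := A n `\` A n.+1.
have Jlt m n i : J m i -> J n i -> ~ (m < n)%N by move=> [_ nAi] [Ai _] /Asub/(_ _ Ai).
(* The layers [J n] are disjoint. Points in no layer get 0, which is harmless as the fibre of [n]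
   only has to contain [J n]. *)
have /choice[h hP] : forall i, exists n, forall m, J m i -> n = m.
  move=> i; have [[n Jn]|nJ] := pselect (exists n, J n i).
    by exists n => m Jm; have [/(Jlt _ _ _ Jn Jm)|/(Jlt _ _ _ Jm Jn)|] := ltngtP n m.
  by exists 0%N => m Jm; case: nJ; exists m.
exists h => n Fn; have [_ _] := gP _ (nA n); apply; apply: filterS Fn => i /= hn Ji.
exact/hn/hP.
Qed.

Lemma card_lt_succ D T (A : set T) :
  card_lt A [set: succ_card D] -> A #<= [set: D].
Proof.
move=> /andP[_ /negP nKA]; rewrite -(card_le_eql (card_setT A)).
have [//|DA] := card_le_total A D; apply: contrapT => /negP nAD; apply: nKA.
rewrite -(card_le_eqr (card_setT A)).
by apply: (succ_cardP D).2; rewrite /card_lt DA.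
Qed.

Lemma incomplete_ultra_fibres I (D : choiceType) (d : D) (U : set_system I) :
  UltraFilter U -> ~ complete_filter (succ_card D) U ->
  exists h : I -> D, forall S, finite_set S -> ~ U (h @^-1` S).
Proof.
move=> UU /existsNP[G /not_implyP[GU /not_implyP[/card_lt_succ GD nUG]]].
have [f finj] : exists f : G -> D, injective f.
  by apply: setT_le_inj; rewrite (card_le_eql (card_setT G)).
have /choice[e eP] : forall x, exists A, U A /\ forall B : G, f B = x -> val B = A.
  move=> x; have [[B <-]|nB] := pselect (exists B, f B = x).
    by exists (val B); split=> [|C /finj->//]; exact: GU (set_mem (valP B)).
  by exists setT; split=> [|B fB]; [exact: filterT|case: nB; exists B].
have /choice[h hP] : forall i, exists x, ~ (\bigcap_(A in G) A) i -> ~ e x i.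
  move=> i; have [Gi|/existsNP[A /not_implyP[GA nAi]]] :=
    pselect ((\bigcap_(A in G) A) i); first by exists d.
  exists (f (SigSub (mem_set GA))) => _.
  by rewrite -((eP _).2 _ erefl).
exists h => S Sfin US.
have [//|UG] := in_ultra_setVsetC (\bigcap_(A in G) A) UU.
have Ue : U (\bigcap_(x in S) e x).
  by rewrite -(fset_setK Sfin); apply: filter_bigI => x _; exact: (eP x).1.
have [i [[Shi nGi] ei]] := filter_ex (filterI (filterI US UG) Ue).
exact: hP nGi (ei _ Shi).
Qed.

Lemma finite_complete_filter I D (F : set_system I) : Filter F ->
  finite_set [set: D] -> complete_filter (succ_card D) F.
Proof.
move=> FF Dfin G GF /card_lt_succ/card_le_finite/(_ Dfin) Gfin.
rewrite -(fset_setK Gfin); apply: filter_bigI => A.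
by rewrite in_fset_set// inE => /GF.
Qed.

(** * The dimension of a reduced power *)

Lemma card_eq_basis (R : pzRingType) (V : lmodType R) (B : set V) :
  is_basis B -> [set: nat] #<= B -> [set: R] #<= B -> B #= [set: V].
Proof.
move=> [_ Bspan] Binf RB; rewrite card_eq_le; apply/andP; split; first exact: card_leT.
rewrite -!(card_le_eqr (card_setT B)) in Binf RB *.
have RBB : [set: R * B] #<= [set: B].
  by apply: card_le_trans (card_le_square Binf); exact: card_le_prod.
have RBinf : [set: nat] #<= [set: R * B].
  by apply: card_le_trans Binf _; apply: (@inj_setT_le _ _ (fun b => (0, b))) => b b' [].
apply: card_le_trans RBB; apply: card_le_trans (card_le_seq RBinf).
have [e _] := setT_le_inj Binf.
have /choice[w wK] : forall u, exists b : B, B u -> val b = u.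
  move=> u; have [Bu|nBu] := pselect (B u); last by exists (e 0%N).
  by exists (SigSub (mem_set Bu)).
(* A vector is recovered from its list of scalars and basis vectors, so [l] is injective. *)
have /choice[l lP] : forall v, exists l : seq (R * B), v = \sum_(p <- l) p.1 *: val p.2.
  move=> v; have [s [c [sB ->]]] := Bspan v; exists [seq (c u, w u) | u <- s].
  by rewrite big_map !big_seq; apply: eq_bigr => u us /=; rewrite wK//; exact: sB.
by apply: (@inj_setT_le _ _ l) => u v uv; rewrite (lP u) uv -lP.
Qed.

Section Pullback.
Variables (R : pzRingType) (V : lmodType R) (I T : Type) (F : filter_on I).
Variable h : I -> T.

(** A linear map whose kernel consists of the [g] whose zero set has its preimage under [h] in [F];
    it transports independent families to the reduced power. *)
Definition rp_pullback (g : T -> V) : reduced_power V F :=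
  \pi_(reduced_power V F)%qT (g \o h).

Lemma rp_pullback_linear : linear rp_pullback.
Proof.
move=> k a b; rewrite [k *: rp_pullback a](rp_scaleE F k (a \o h)).
exact: esym (rp_addE F (k *: (a \o h)) (b \o h)).
Qed.

HB.instance Definition _ := GRing.isLinear.Build R (T -> V) (reduced_power V F)
  _ rp_pullback rp_pullback_linear.

Lemma rp_pullback_eq0 g :
  rp_pullback g = 0 -> (F : set_system I) [set i | g (h i) = 0].
Proof. by move=> /(pi_rpE F (g \o h) 0). Qed.

End Pullback.

Lemma infinite_fibres (D : choiceType) I (F : filter_on I) :
  [set: nat] #<= [set: D] ->
  ~ finite_inter_complete_ultrafilters (succ_card D) F ->
  exists h : I -> D, forall S, finite_set S -> ~ (F : set_system I) (h @^-1` S).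
Proof.
move=> Dinf nF; have [e einj] := setT_le_inj Dinf.
have [[S [Sfin SU FS]]|nFS] := pselect (finite_inter_ultrafilters F).
  have [U [US nU]] : exists U, S U /\ ~ complete_filter (succ_card D) U.
    apply: contrapT => /forallNP nU; apply: nF; exists S; split=> // U US.
    by split; [exact: SU|apply: contrapT => nUc; apply: (nU U)].
  have [h hP] := incomplete_ultra_fibres (e 0%N) (SU _ US) nU.
  by exists h => A Afin; rewrite FS => /(_ _ US); exact: hP.
have [h hP] := nonultra_nat_fibres _ nFS; exists (e \o h) => A Afin FA.
(* The preimage of [A] under [e \o h] avoids the fibre of [n] as soon as [e n] is outside the finite
   set [A]. *)
have [n nA] : exists n, ~ A (e n).
  apply: contrapT => /forallNP eA; apply: infinite_nat.
  have := finite_preimage (in2W einj) Afin; apply: sub_finite_set => n _.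
  exact: contrapT (eA n).
by apply: (hP n); apply: filterS FA => i /= Ai hin; apply: nA; rewrite -hin.
Qed.

Lemma indep_delta (R : pzRingType) (T : choiceType) : 1 != 0 :> R ->
  let delta (n : T) : T -> R^o := fun m => if m == n then 1 else 0 in
  indep_mod [set 0] (range delta) /\ injective delta.
Proof.
move=> R1 delta; have dinj : injective delta.
  move=> m n /(congr1 (fun f => f m)); rewrite /delta eqxx; case: eqVneq => // _ /eqP.
  by rewrite (negbTE R1).
split=> // s c s_uniq sd s0 v vs; have [n _ dn] := sd _ vs; subst v.
have := congr1 (fun f => f n) s0; rewrite fct_sumE (bigD1_seq (delta n))//=.
rewrite big_seq_cond big1 => [|w /andP[/sd[m _ dm] wn]]; last first.
  subst w.
  rewrite -[LHS]/(c (delta m) * delta m n) {2}/delta.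
  by case: (eqVneq n m) wn => [->|_ _]; rewrite ?eqxx ?mulr0.
by rewrite addr0 -[X in X = _ -> _]/(c (delta n) * delta n n) /delta eqxx mulr1.
Qed.

Lemma reduced_power_large_indep (D : unitRingType) (divD : GRing.field_axiom D)
    (I : Type) (F : filter_on I) :
  ~ finite_inter_complete_ultrafilters (succ_card D) F ->
  exists A : set (reduced_power D^o F),
    [/\ lin_indep A, [set: nat] #<= A & [set: D] #<= A].
Proof.
move=> nF; have [Dfin|/infiniteP Dinf] := pselect (finite_set [set: D]).
  have nFU : ~ finite_inter_ultrafilters F.
    move=> [S [Sfin SU FS]]; apply: nF; exists S; split=> // U US.
    by split; [exact: SU|have UU := SU _ US; exact: finite_complete_filter].
  have [h hP] := nonultra_nat_fibres _ nFU.
  have [dind dinj] := @indep_delta D nat (oner_neq0 D).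
  have [|phi_inj phi_ind] := indep_mod_image (phi := rp_pullback F h) (oner_neq0 D) _ dind.
    (* The pullback is injective: if [g n] were nonzero, the preimage of the zero set of [g] would
       avoid the fibre of [n]. *)
    move=> g /rp_pullback_eq0 Fg; apply/funext => n; apply: contrapT => gn.
    by apply: (hP n); apply: filterS Fg => i /= gi hin; apply: gn; rewrite -hin.
  have natA := card_esym (card_eq_trans (inj_card_eq phi_inj) (inj_card_eq (in2W dinj))).
  eexists; split; [exact: phi_ind|by rewrite (card_le_eql natA)|].
  by rewrite -(card_le_eqr natA); exact: finite_set_countable.
have [h hP] := infinite_fibres Dinf nF; have [G DG Gind] := strong_family divD Dinf.
have [|phi_inj phi_ind] := indep_mod_image (phi := rp_pullback F h) (oner_neq0 D) _ Gind.
  by move=> g /rp_pullback_eq0 Fg zfin; exact: hP zfin Fg.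
have DA : [set: D] #<= rp_pullback F h @` G by rewrite (card_le_eqr (inj_card_eq phi_inj)).
by eexists; split; [exact: phi_ind|exact: card_le_trans DA|].
Qed.

Lemma dim_reduced_power (D : unitRingType) (divD : GRing.field_axiom D)
    (I : Type) (F : filter_on I) :
  ~ finite_inter_complete_ultrafilters (succ_card D) F ->
  dim_eq_card (reduced_power D^o F) [set: reduced_power D^o F].
Proof.
move=> nF; have [A [Aind natA DA]] := reduced_power_large_indep divD nF.
have [||||B [AB Bind Bmax]] := @indep_mod_maximal D _ [set 0] A.
- by move=> x x0; exists x^-1; rewrite mulVr//; exact: divD.
- by [].
- by move=> a v ->; rewrite /= scaler0.
- exact: Aind.
have Bbasis : is_basis B.
  split=> [|v]; first exact: Bind.
  have [s [c [sB /eqP]]] := Bmax v; rewrite subr_eq0 => /eqP vE.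
  by exists s, c.
exists B => //; apply: card_eq_basis => //.
  exact: card_le_trans natA (subset_card_le AB).
exact: card_le_trans DA (subset_card_le AB).
Qed.

Theorem corollary13 (D : unitRingType) (divD : GRing.field_axiom D)
    (I : Type) (F : filter_on I) :
  ~ finite_inter_complete_ultrafilters (succ_card D) F ->
  dim_eq_card (reduced_power D^o F) [set: reduced_power D^o F] /\
  dim_eq_card (reduced_power (D^c)^o F) [set: reduced_power (D^c)^o F].
Proof.
move=> nF; split; first exact: dim_reduced_power.
(* The converse ring has the same elements and units as [D], so both hypotheses carry over by
   conversion. *)
exact: (@dim_reduced_power (D^c) divD).
Qed.
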